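(* Let $T_0$ be a dotted increasing tableau of hook-closed shape. Assume that every dot in $T_0$ is situated (immediately) to the right of an integer and (immediately) above another integer. Then all resolutions of $T_0$ are $K$-Knuth equivalent.
   Context: **Boxes.** Elements $[r,c]$ of $\mathbb{N}^2$ are boxes in row $r$ (rows numbered from top to bottom) and column $c$ (columns numbered from left to right), with $[r_1,c_1]\le[r_2,c_2]$ iff $r_1\le r_2$ and $c_1\le c_2$. Box $[i_1,j_1]$ is north of $[i_2,j_2]$ if $i_1\le i_2$, strictly north if $i_1<i_2$; east of it if $j_1\ge j_2$, strictly east if $j_1>j_2$; similarly for south and west. North-east means north and east. A finite subset $\theta\subset\mathbb{N}^2$ is a hook-closed shape if whenever $[i_1,j_1]\le[i_2,j_2]$ are both in $\theta$, then $\theta$ contains all boxes $[i_1,c]$ with $j_1\le c\le j_2$ and all boxes $[r,j_2]$ with $i_1\le r\le i_2$. **Tableaux.** For a hook-closed shape $\theta$, a weakly increasing tableau is a map $\theta\to\mathbb{Z}$ whose rows weakly increase from left to right and whose columns weakly increase from top to bottom; it is (strictly) increasing if all rows and columns are strictly increasing. **Reading words.** A reading word of a weakly increasing tableau $T$ of hook-closed shape is any word listing the (entries of the) boxes of $T$ in an order for which (i) each box $\alpha$ appears before all other boxes north-east of $\alpha$; (ii) if a box $\alpha$ has the same value as the box immediately above $\alpha$, then $\alpha$ appears before all boxes strictly north of $\alpha$; (iii) if a box $\alpha$ has the same value as the box immediately to the right of $\alpha$, then $\alpha$ appears before all boxes strictly east of $\alpha$. **$K$-Knuth equivalence.** The relation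 $\equiv$ on words of integers is the equivalence relation generated by the following, for all words $\mathbf{u},\mathbf{v}$ and integers $a,b,c$: $(\mathbf{u},a,a,\mathbf{v})\equiv(\mathbf{u},a,\mathbf{v})$; $(\mathbf{u},a,b,a,\mathbf{v})\equiv(\mathbf{u},b,a,b,\mathbf{v})$; $(\mathbf{u},a,b,c,\mathbf{v})\equiv(\mathbf{u},a,c,b,\mathbf{v})$ if $b<a<c$; $(\mathbf{u},a,b,c,\mathbf{v})\equiv(\mathbf{u},b,a,c,\mathbf{v})$ if $a<c<b$. Two weakly increasing tableaux $T_1,T_2$ of hook-closed shapes admitting reading words are $K$-Knuth equivalent if a reading word of $T_1$ is $K$-Knuth equivalent to a reading word of $T_2$ (all reading words of a given tableau are $K$-Knuth equivalent, and every resolution of a dotted increasing tableau admits a reading word). **Dotted tableaux and resolutions.** A dotted increasing tableau of hook-closed shape $\theta$ is a map $T_0:\theta\to\mathbb{Z}\cup\{\bullet\}$ for which there is an integer $k$ such that replacing every dot $\bullet$ with $k+\frac12$ gives a strictly increasing tableau of rational numbers. A resolution of $T_0$ is any tableau obtained by replacing each dot with either the maximum of the (existing) boxes immediately above and immediately to the left of the dot, or the minimum of the (existing) boxes immediately below and immediately to the right of the dot (independently for each dot). If there are no boxes immediately above or to the left of a dot, or if there are no boxes immediately below or to the right of a dot, then the box containing the dot may be removed. *)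

(* Defs.v *)
From Stdlib Require Import Relations.
From mathcomp Require Import all_boot all_order all_algebra.
From mathcomp Require Import finmap.

Set Implicit Arguments.
Unset Strict Implicit.
Unset Printing Implicit Defensive.

Import Order.TTheory GRing.Theory Num.Theory.

Local Open Scope ring_scope.

(* A box (r, c) lies in row r and column c; rows are numbered from top to
   bottom and columns from left to right. *)
Definition box := (nat * nat)%type.

Definition box_le (a b : box) : bool := (a.1 <= b.1)%N && (a.2 <= b.2)%N.
(* [b] lies north(-east) of [a]; "strictly north" and "strictly east" each
   constrain a single coordinate. *)
Definition north_east_of (a b : box) : bool :=
  (b.1 <= a.1)%N && (a.2 <= b.2)%N.
Definition strictly_north_of (a b : box) : bool := (b.1 < a.1)%N.
Definition strictly_east_of (a b : box) : bool := (a.2 < b.2)%N.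

(* Adjacency is always expressed through these two injective maps: [a] is
   immediately above [b] iff [below a = b], and immediately to the left of [b]
   iff [right_of a = b]. This avoids truncated predecessors at row or column 0. *)
Definition below (a : box) : box := (a.1.+1, a.2).
Definition right_of (a : box) : box := (a.1, a.2.+1).

Definition hook_closed (theta : {fset box}) : Prop :=
  forall a b : box, a \in theta -> b \in theta -> box_le a b ->
    (forall c : nat, (a.2 <= c <= b.2)%N -> (a.1, c) \in theta) /\
    (forall r : nat, (a.1 <= r <= b.1)%N -> (r, b.2) \in theta).

Definition weakly_increasing (disp : Order.disp_t) (V : porderType disp)
    (T : {fmap box -> V}) : Prop :=
  (forall (r c1 c2 : nat) (x1 x2 : V), (c1 < c2)%N ->
     T.[? (r, c1)]%fmap = Some x1 -> T.[? (r, c2)]%fmap = Some x2 ->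
     (x1 <= x2)%O) /\
  (forall (c r1 r2 : nat) (x1 x2 : V), (r1 < r2)%N ->
     T.[? (r1, c)]%fmap = Some x1 -> T.[? (r2, c)]%fmap = Some x2 ->
     (x1 <= x2)%O).

Definition strictly_increasing (disp : Order.disp_t) (V : porderType disp)
    (T : {fmap box -> V}) : Prop :=
  (forall (r c1 c2 : nat) (x1 x2 : V), (c1 < c2)%N ->
     T.[? (r, c1)]%fmap = Some x1 -> T.[? (r, c2)]%fmap = Some x2 ->
     (x1 < x2)%O) /\
  (forall (c r1 r2 : nat) (x1 x2 : V), (r1 < r2)%N ->
     T.[? (r1, c)]%fmap = Some x1 -> T.[? (r2, c)]%fmap = Some x2 ->
     (x1 < x2)%O).

Definition weakly_increasing_tableau (T : {fmap box -> int}) : Prop :=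
  hook_closed (domf T) /\ weakly_increasing T.

(* The order in which a reading word lists the boxes; [index a s < index b s]
   says that [a] appears before [b]. *)
Definition reading_order (T : {fmap box -> int}) (s : seq box) : Prop :=
  [/\ uniq s,
      s =i domf T,
      (forall a b : box, a \in domf T -> b \in domf T ->
         b != a -> north_east_of a b -> (index a s < index b s)%N),
      (forall a a' b : box, a \in domf T -> a' \in domf T -> b \in domf T ->
         below a' = a -> T.[? a']%fmap = T.[? a]%fmap ->
         strictly_north_of a b -> (index a s < index b s)%N)
    & (forall a a' b : box, a \in domf T -> a' \in domf T -> b \in domf T ->
         right_of a = a' -> T.[? a']%fmap = T.[? a]%fmap ->
         strictly_east_of a b -> (index a s < index b s)%N)].

Definition reading_word (T : {fmap box -> int}) (w : seq int) : Prop :=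
  exists2 s : seq box,
    reading_order T s & w = pmap (fun b : box => T.[? b]%fmap) s.

Inductive K_Knuth_step : seq int -> seq int -> Prop :=
| KK_idem (u v : seq int) (a : int) :
    K_Knuth_step (u ++ [:: a; a] ++ v) (u ++ [:: a] ++ v)
| KK_braid (u v : seq int) (a b : int) :
    K_Knuth_step (u ++ [:: a; b; a] ++ v) (u ++ [:: b; a; b] ++ v)
| KK_swap_right (u v : seq int) (a b c : int) : b < a -> a < c ->
    K_Knuth_step (u ++ [:: a; b; c] ++ v) (u ++ [:: a; c; b] ++ v)
| KK_swap_left (u v : seq int) (a b c : int) : a < c -> c < b ->
    K_Knuth_step (u ++ [:: a; b; c] ++ v) (u ++ [:: b; a; c] ++ v).

Definition K_Knuth_word : seq int -> seq int -> Prop :=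
  clos_refl_sym_trans (seq int) K_Knuth_step.

Definition K_Knuth_equivalent (T1 T2 : {fmap box -> int}) : Prop :=
  [/\ weakly_increasing_tableau T1,
      weakly_increasing_tableau T2
    & exists w1 w2 : seq int,
        [/\ reading_word T1 w1, reading_word T2 w2 & K_Knuth_word w1 w2]].

(* In a dotted tableau the value [None] stands for a dot, so that
   [T0.[? b] = Some None] means that [b] is a box of [T0] containing a dot,
   whereas [T0.[? b] = None] means that [b] is not a box of [T0]. *)
Definition dotted_map := {fmap box -> option int}.

Definition has_dot (T0 : dotted_map) (b : box) : Prop :=
  T0.[? b]%fmap = Some None.

Definition has_int (T0 : dotted_map) (b : box) (x : int) : Prop :=
  T0.[? b]%fmap = Some (Some x).

Definition replace_dots (T0 : dotted_map) (q : rat) : {fmap box -> rat} :=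
  [fmap b : domf T0 => if T0 b is Some x then x%:Q else q]%fmap.

Definition dotted_increasing_tableau (T0 : dotted_map) : Prop :=
  hook_closed (domf T0) /\
  exists k : int, strictly_increasing (replace_dots T0 (k%:Q + 2%:R^-1)).

Definition above_or_left (a b : box) : Prop := below a = b \/ right_of a = b.

(* In a dotted increasing tableau no two dots are adjacent, so the boxes
   adjacent to a dot all contain integers. *)
Definition max_above_left (T0 : dotted_map) (b : box) (x : int) : Prop :=
  (exists2 a : box, above_or_left a b & has_int T0 a x) /\
  (forall (a : box) (y : int), above_or_left a b -> has_int T0 a y -> y <= x).

Definition min_below_right (T0 : dotted_map) (b : box) (x : int) : Prop :=
  (exists2 a : box, above_or_left b a & has_int T0 a x) /\
  (forall (a : box) (y : int), above_or_left b a -> has_int T0 a y -> x <= y).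

Definition removable (T0 : dotted_map) (b : box) : Prop :=
  (forall a : box, above_or_left a b -> a \notin domf T0) \/
  (forall a : box, above_or_left b a -> a \notin domf T0).

(* The possible contents of a dotted box in a resolution; [None] means that the
   box is removed. *)
Inductive resolves_dot (T0 : dotted_map) (b : box) : option int -> Prop :=
| Resolve_max (x : int) : max_above_left T0 b x -> resolves_dot T0 b (Some x)
| Resolve_min (x : int) : min_below_right T0 b x -> resolves_dot T0 b (Some x)
| Resolve_remove : removable T0 b -> resolves_dot T0 b None.

Definition resolution (T0 : dotted_map) (T : {fmap box -> int}) : Prop :=
  forall b : box,
    match T0.[? b]%fmap with
    | None => T.[? b]%fmap = None
    | Some (Some x) => T.[? b]%fmap = Some x
    | Some None => resolves_dot T0 b T.[? b]%fmap
    end.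

(* Main.v *)
Require Import Defs.
From Stdlib Require Import Relations.
From mathcomp Require Import all_boot all_order all_algebra.
From mathcomp Require Import finmap zify.

(* The dots of a dotted increasing tableau form a chain d_1, d_2, ... going
   strictly north-east. A resolution can be read by listing the boxes
   south-west of d_1 (ending with d_1), then the remaining boxes south-west of
   d_2, and so on. If d_i equals its left (or lower) neighbour, one first lists
   the boxes south-west of that neighbour. Let x, y be the left and lower
   neighbours of a dot and z the value given to it. Up to K-Knuth equivalence
   the part of the word ending at the dot is P y x y if z = y and P x y z
   otherwise, where P does not depend on the resolution; thus z = x and z = y
   are equivalent by x y x = y x y. If z is the value a of the upper neighbour,
   then the rest of the word, which for a strictly increasing hook-closed tableau
   may be read in any south-west to north-east order, can be chosen to begin
   with the part of the row of a that ends at a; this allows to replace z by x.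
   The case of the right neighbour is symmetric under negation of letters. The
   dots are treated from north-east to south-west, and the freedom of choosing
   the beginning of the word is part of the induction hypothesis. *)

Set Implicit Arguments.
Unset Strict Implicit.
Unset Printing Implicit Defensive.

Import Order.TTheory GRing.Theory Num.Theory.

Local Open Scope fset_scope.
Local Open Scope ring_scope.

Local Notation "w1 ~K w2" := (K_Knuth_word w1 w2) (at level 70).
Local Notation sw := north_east_of.

(** * K-Knuth relations between words *)

Lemma KK_refl w : w ~K w. Proof. exact: rst_refl. Qed.

Lemma KK_sym w1 w2 : w1 ~K w2 -> w2 ~K w1. Proof. exact: rst_sym. Qed.

Lemma KK_trans w2 w1 w3 : w1 ~K w2 -> w2 ~K w3 -> w1 ~K w3.
Proof. exact: rst_trans. Qed.

Lemma KK_cat u v w1 w2 : w1 ~K w2 -> u ++ w1 ++ v ~K u ++ w2 ++ v.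
Proof.
elim=> [w w' s|w|w w' _ ?|w w' w'' _ ? _ ?]; last 3 first.
- exact: KK_refl.
- exact: KK_sym.
- by apply: KK_trans; eassumption.
apply: rst_step; case: s => [p q a|p q a b|p q a b c h1 h2|p q a b c h1 h2];
  rewrite -!catA !(catA u).
- exact: KK_idem.
- exact: KK_braid.
- exact: KK_swap_right.
- exact: KK_swap_left.
Qed.

Lemma KK_catl u w1 w2 : w1 ~K w2 -> u ++ w1 ~K u ++ w2.
Proof. by move=> h; have := KK_cat u [::] h; rewrite !cats0. Qed.

Lemma KK_catr v w1 w2 : w1 ~K w2 -> w1 ++ v ~K w2 ++ v.
Proof. exact: (KK_cat [::]). Qed.

Lemma KK_cons a w1 w2 : w1 ~K w2 -> a :: w1 ~K a :: w2.
Proof. exact: (KK_catl [:: a]). Qed.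

(** Negation reverses the order of letters and keeps their positions, so it maps each Knuth relation
    to itself read backwards. *)
Lemma KK_opp w1 w2 : w1 ~K w2 -> map -%R w1 ~K map -%R w2.
Proof.
elim=> [w w' s|w|w w' _ ?|w w' w'' _ ? _ ?]; last 3 first.
- exact: KK_refl.
- exact: KK_sym.
- by apply: KK_trans; eassumption.
case: s => [p q a|p q a b|p q a b c h1 h2|p q a b c h1 h2]; rewrite !map_cat.
- exact/rst_step/KK_idem.
- exact/rst_step/KK_braid.
- by apply/KK_sym/rst_step/KK_swap_right; rewrite ltrN2.
- by apply/KK_sym/rst_step/KK_swap_left; rewrite ltrN2.
Qed.

Lemma KK_dup a t : a :: a :: t ~K a :: t.
Proof. exact/rst_step/(KK_idem [::]). Qed.

Lemma KK_aba a b t : a :: b :: a :: t ~K b :: a :: b :: t.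
Proof. exact/rst_step/(KK_braid [::]). Qed.

Lemma KK_left_witness a b c t : b < a < c -> a :: b :: c :: t ~K a :: c :: b :: t.
Proof. by case/andP=> h1 h2; apply/rst_step/(KK_swap_right [::]). Qed.

Lemma KK_right_witness a b c t : a < c < b -> a :: b :: c :: t ~K b :: a :: c :: t.
Proof. by case/andP=> h1 h2; apply/rst_step/(KK_swap_left [::]). Qed.

(** [m] passes the letters of [M] from the last to the first. The witness to its right is at first
    [w] and afterwards the letter just passed. *)
Lemma KK_commute1 (M : seq int) m w t :
  pairwise >%R M -> m < w -> all (> w) M ->
  M ++ m :: w :: t ~K m :: M ++ w :: t.
Proof.
elim/last_ind: M w t => [|M z IH] w t; first by move=> *; apply: KK_refl.
rewrite -cats1 pairwise_cat all_cat /= !andbT !cats1 allrel1r => /andP[zM pM] mw /andP[_ wz].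
rewrite -!cats1 -!catA /=.
apply: (@KK_trans (M ++ [:: m, z, w & t])).
  apply: KK_catl; apply/KK_sym/KK_right_witness; lia.
by apply: IH => //; lia.
Qed.

(** The letters of [m] pass [M] one at a time, the first one first. Each has as witness the next
    letter of [m], or [w] for the last one. *)
Lemma KK_commute (M m : seq int) w t :
  pairwise >%R M -> pairwise <%R m -> all (< w) m -> all (> w) M ->
  M ++ m ++ w :: t ~K m ++ M ++ w :: t.
Proof.
move=> pM + + wM; elim: m => [|a m IH] /=; first by move=> *; apply: KK_refl.
case/andP=> am pm /andP[aw mw].
apply: KK_trans (KK_cons a (IH pm mw)).
case: m am mw {IH pm} => [|b m] /=; first by move=> *; apply: KK_commute1.
case/andP=> ab _ /andP[bw _]; apply: KK_commute1 => //.
by apply: sub_all wM => z /=; lia.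
Qed.

(** In the application [x], [y], [a] belong to the left, lower and upper neighbours of a dot, and
    [us] is the part of the row of [a] to the left of [a]. *)
Lemma KK_dot_above x y a us t :
  pairwise <%R us -> all (< x) us -> x < a < y ->
  [:: y, x, y & us ++ a :: t] ~K [:: y, x, a & us ++ a :: t].
Proof.
move=> pu ux xay.
have xya s : [:: x, y, a & s] ~K [:: y, x, a & s] by apply: KK_right_witness.
case/lastP: us pu ux => [|us u] /=.
  move=> _ _; apply: (@KK_trans [:: y, x, a & t]).
    exact: KK_trans (KK_cons y (xya t)) (KK_dup _ _).
  by do 2 apply: KK_cons; apply/KK_sym/KK_dup.
rewrite -cats1 pairwise_cat all_cat /= !andbT allrel1r => /andP[uu pu] /andP[ux u_x].
rewrite -catA /=.
have uy : all (< y) us by apply: sub_all ux => z /=; lia.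
have to_front s : [:: y, x & us ++ u :: s] ~K us ++ [:: y, x, u & s].
  apply: (@KK_trans (y :: us ++ [:: x, u & s])).
    by apply/KK_cons/(@KK_commute [:: x]); rewrite //= u_x.
  by apply: (@KK_commute [:: y]); rewrite //= ?andbT; lia.
have tail s : x :: u :: a :: s ~K x :: a :: u :: s.
  by apply: KK_left_witness; lia.
(* Common form of both sides: the row without its last letter [u] moves to the front, and [u] ends
   up behind [a]. On the left side the braid relation turns [y, x, y] into [x, y, x] and back, so
   that [x] can be the witness for exchanging [u] and [a]. *)
apply: (@KK_trans (us ++ [:: y, x, a, u & t])).
  apply: (@KK_trans [:: y, x & us ++ [:: u, y, a & t]]).
    do 2 apply: KK_cons; have := @KK_commute [:: y] (rcons us u) a t.
    rewrite -!cats1 -!catA /=; apply=> //; rewrite ?andbT.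
    - by rewrite pairwise_cat /= allrel1r uu pu.
    - rewrite all_cat /= andbT; apply/andP; split; last by lia.
      by apply: sub_all ux => z /=; lia.
    - by lia.
  apply: KK_trans (to_front _) _; apply: KK_catl.
  apply: (@KK_trans [:: y, x, y, u, a & t]).
    by apply/KK_cons/KK_left_witness; lia.
  apply: KK_trans (KK_aba _ _ _) _.
  apply: (@KK_trans [:: x, y, x, a, u & t]).
    by do 2 apply: KK_cons; apply: tail.
  apply: KK_trans (KK_aba _ _ _) _.
  exact: KK_trans (KK_cons y (xya _)) (KK_dup _ _).
apply/KK_sym/(@KK_trans [:: y, x & us ++ [:: u, a, u & t]]).
  do 2 apply: KK_cons; apply: (@KK_trans (us ++ [:: a, u, a & t])).
    apply: (@KK_commute [:: a]) => //=; rewrite ?andbT; lia.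
  exact/KK_catl/KK_aba.
apply: KK_trans (to_front _) _; apply/KK_catl/KK_cons.
apply: KK_trans (tail _) _; do 2 apply: KK_cons; exact: KK_dup.
Qed.

(** This is [KK_dot_above] for the negated letters, with the roles of [x] and [y] exchanged. *)
Lemma KK_dot_right x y b vs t :
  pairwise >%R vs -> all (> y) vs -> x < b < y ->
  [:: x, y, x & vs ++ b :: t] ~K [:: x, y, b & vs ++ b :: t].
Proof.
move=> pv yv xby.
have := @KK_dot_above (- y) (- x) (- b) (map -%R vs) (map -%R t).
rewrite pairwise_map all_map => /(_ _ _ _) H.
have /KK_opp : [:: - x, - y, - x & map -%R vs ++ - b :: map -%R t] ~K
         [:: - x, - y, - b & map -%R vs ++ - b :: map -%R t].
  apply: H; last by lia.
    by apply: sub_pairwise pv => p q /=; lia.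
  by apply: sub_all yv => p /=; lia.
by rewrite /= !map_cat /= !(mapK opprK) !opprK.
Qed.

(** * Strictly increasing tableaux *)

Lemma box_eq (a b : box) : a.1 = b.1 -> a.2 = b.2 -> a = b.
Proof. by case: a b => [? ?] [? ?] /= -> ->. Qed.

Lemma box_neq (a b : box) : a != b -> a.1 <> b.1 \/ a.2 <> b.2.
Proof. by case: a b => [? ?] [? ?]; rewrite xpair_eqE negb_and => /orP[]/eqP; auto. Qed.

(** [sw a b] says that [a] is south-west of [b], so this is condition (i) on reading words. As [sw]
    is reflexive, repeated boxes are excluded too. *)
Definition listing (A : {fset box}) (s : seq box) : Prop :=
  pairwise (fun a b => ~~ sw b a) s /\ s =i A.

Definition minimal_in (A : {fset box}) (a : box) : Prop :=
  a \in A /\ forall b : box, b \in A -> sw b a -> b = a.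

Definition increasing_on (v : box -> int) (A : {fset box}) : Prop :=
  (forall a b : box, a \in A -> b \in A -> a.1 = b.1 -> (a.2 < b.2)%N -> v a < v b) /\
  (forall a b : box, a \in A -> b \in A -> a.2 = b.2 -> (a.1 < b.1)%N -> v a < v b).

Lemma increasing_onS v (A B : {fset box}) :
  {subset B <= A} -> increasing_on v A -> increasing_on v B.
Proof.
by move=> sBA [hr hc]; split=> a b /sBA aA /sBA bA; [apply: hr | apply: hc].
Qed.

Lemma hook_row A (a b : box) c : hook_closed A -> a \in A -> b \in A -> (a.1 <= b.1)%N ->
  (a.2 <= c <= b.2)%N -> (a.1, c) \in A.
Proof.
move=> hA aA bA ab abc; case: (hA a b) => // [|h _]; last exact: h.
by rewrite /box_le ab; lia.
Qed.

Lemma hook_col A (a b : box) r : hook_closed A -> a \in A -> b \in A -> (a.2 <= b.2)%N ->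
  (a.1 <= r <= b.1)%N -> (r, b.2) \in A.
Proof.
move=> hA aA bA ab abr; case: (hA a b) => // [|_ h]; last exact: h.
by rewrite /box_le ab; lia.
Qed.

Definition restr (A : {fset box}) (P : box -> bool) : {fset box} := [fset p in A | P p].

Lemma in_restr A P (p : box) : (p \in restr A P) = (p \in A) && P p.
Proof. by rewrite !inE. Qed.

Lemma hook_closed_sw A f : hook_closed A -> hook_closed (restr A (sw^~ f)).
Proof.
move=> hA a b; rewrite !in_restr => /andP[aA af] /andP[bA bf] ab.
have [hr hc] := hA a b aA bA ab; move: ab af bf; rewrite /box_le /sw => ab af bf.
by split=> n hn; rewrite in_restr /sw /= ?hr ?hc //; lia.
Qed.

Lemma hook_closed_nsw A f : hook_closed A -> hook_closed (restr A (fun p => ~~ sw p f)).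
Proof.
move=> hA a b; rewrite !in_restr => /andP[aA af] /andP[bA bf] ab.
have [hr hc] := hA a b aA bA ab; move: ab af bf; rewrite /box_le /sw => ab af bf.
by split=> n hn; rewrite in_restr /sw /= ?hr ?hc //; lia.
Qed.

Lemma hook_closed_minimal A a :
  hook_closed A -> minimal_in A a -> hook_closed (A `\ a).
Proof.
move=> hA [aA amin]; suff -> : A `\ a = restr A (fun p => ~~ sw p a).
  exact: hook_closed_nsw.
apply/fsetP => p; rewrite !inE /= andbC; case pA: (p \in A) => //=.
congr (~~ _); apply/eqP/idP => [->|/(amin _ pA)//].
by rewrite /sw !leqnn.
Qed.

Lemma listing_cons A a s : listing A (a :: s) <-> minimal_in A a /\ listing (A `\ a) s.
Proof.
split=> [[/= /andP[/allP ha hs] mA]|[[aA amin] [hs mA]]].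
  have anin : a \notin s by apply/negP => /ha; rewrite /sw !leqnn.
  split; first split.
  - by rewrite -mA mem_head.
  - by move=> b; rewrite -mA inE => /predU1P[//|/ha /negP].
  - split=> // p; rewrite !inE -mA inE.
    by case: eqP => // ->; rewrite (negbTE anin).
split=> [|p] /=; last by rewrite inE mA !inE; case: eqP => // ->.
rewrite hs andbT; apply/allP => b; rewrite mA !inE => /andP[/eqP ba bA].
by apply/negP => /amin -/(_ bA).
Qed.

Lemma listing_cat A s1 s2 B1 B2 : listing B1 s1 -> listing B2 s2 ->
  (forall p : box, (p \in A) = (p \in B1) || (p \in B2)) ->
  (forall p q : box, p \in B1 -> q \in B2 -> ~~ sw q p) -> listing A (s1 ++ s2).
Proof.
move=> [h1 m1] [h2 m2] mA h; split; last by move=> p; rewrite mem_cat mA m1 m2.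
rewrite pairwise_cat h1 h2 !andbT; apply/allrelP => p q.
by rewrite m1 m2; apply: h.
Qed.

(** The row reading order, rows from bottom to top; it serves wherever some listing is needed. *)
Definition row_listing (A : {fset box}) : seq box :=
  sort (fun a b => (b.1 < a.1)%N || (b.1 == a.1) && (a.2 <= b.2)%N) A.

Lemma row_listingP A : listing A (row_listing A).
Proof.
split; last by move=> p; rewrite mem_sort.
rewrite /row_listing; set le := (X in sort X).
have le_tr : transitive le by move=> [? ?] [? ?] [? ?]; rewrite /le /=; lia.
have le_tot : total le by move=> [? ?] [? ?]; rewrite /le /=; lia.
have pu : pairwise [rel x y | x != y] (sort le A).
  by rewrite -uniq_pairwise sort_uniq fset_uniq.
have pl : pairwise le (sort le A) by rewrite -sorted_pairwise // sort_sorted.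
have := conj pu pl => /andP; rewrite -pairwise_relI.
by apply: sub_pairwise => a b /= /andP[/box_neq]; rewrite /le /sw; lia.
Qed.

Lemma listing_uniq A s : listing A s -> uniq s.
Proof.
case=> h _; rewrite uniq_pairwise; apply: sub_pairwise h => a b /=.
by apply: contra => /eqP ->; rewrite /sw !leqnn.
Qed.

Section StrictTableaux.

Variables (v : box -> int) (A : {fset box}).
Hypotheses (hookA : hook_closed A) (vA : increasing_on v A).

Hypothesis IH : forall a s t, a \in A -> hook_closed (A `\ a) ->
  listing (A `\ a) s -> listing (A `\ a) t -> map v s ~K map v t.

(* Listing a, b, w or b, a, w first gives Knuth equivalent words. *)
Lemma swap_with_witness a b w s t :
  listing A (a :: s) -> listing A (b :: t) -> ~~ sw b a -> ~~ sw a b ->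
  w \in A -> (forall p : box, p \in A -> sw p w -> p \in [:: a; b; w]) ->
  v a < v w < v b -> map v (a :: s) ~K map v (b :: t).
Proof.
move=> /listing_cons[aA sA] /listing_cons[bA tA] nba nab wA wmin vw.
have neq p q : ~~ sw p q -> p != q.
  by apply: contra => /eqP ->; rewrite /sw !leqnn.
have wa : w != a by apply/eqP => e; move: vw; rewrite e ltxx.
have wb : w != b by apply/eqP => e; move: vw; rewrite e ltxx andbF.
(* Both [a, b, w, u] and [b, a, w, u] are listings of [A]. [IH] relates them to [a :: s] and
   [b :: t], and their words differ by one Knuth move. *)
pose u := row_listing (A `\ a `\ b `\ w).
have ls : listing (A `\ a) [:: b, w & u].
  apply/listing_cons; split; last apply/listing_cons; last split.
  - split=> [|p]; rewrite !inE; first by rewrite neq // bA.1.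
    by case/andP=> _ /bA.2.
  - split=> [|p]; rewrite !inE; first by rewrite wa wb.
    by case/and3P=> pb pa pA /(wmin _ pA); rewrite !inE (negbTE pa) (negbTE pb) => /eqP.
  - exact: row_listingP.
have lt : listing (A `\ b) [:: a, w & u].
  apply/listing_cons; split; last apply/listing_cons; last split.
  - split=> [|p]; rewrite !inE; first by rewrite neq // aA.1.
    by case/andP=> _ /aA.2.
  - split=> [|p]; rewrite !inE; first by rewrite wa wb.
    by case/and3P=> pa pb pA /(wmin _ pA); rewrite !inE (negbTE pa) (negbTE pb) => /eqP.
  - suff -> : A `\ b `\ a = A `\ a `\ b by apply: row_listingP.
    by apply/fsetP => p; rewrite !inE andbCA.
have := IH aA.1 (hook_closed_minimal hookA aA) sA ls.
have := IH bA.1 (hook_closed_minimal hookA bA) lt tA.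
move=> /(KK_cons (v b)) ht /(KK_cons (v a)) hs.
apply: KK_trans hs (KK_trans _ ht) => /=.
exact: KK_right_witness.
Qed.

(* If [a] and [b] lie in adjacent columns, the box above [b] is a witness for
   exchanging them. Otherwise the box to the right of [a] is one, unless its
   column contains a minimal box lying between [a] and [b]. *)
Lemma swap_minimal_NW n (a b : box) s t : (b.2 - a.2 <= n)%N ->
  (a.1 < b.1)%N -> (a.2 < b.2)%N ->
  listing A (a :: s) -> listing A (b :: t) -> map v (a :: s) ~K map v (b :: t).
Proof.
elim: n a b s t => [|n IHn] a b s t; first by lia.
move=> ban ab1 ab2 las lbt.
have [[aA amin] _] := (listing_cons _ _ _).1 las.
have [[bA bmin] _] := (listing_cons _ _ _).1 lbt.
have nab : ~~ sw a b by rewrite /sw; lia.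
have nba : ~~ sw b a by rewrite /sw; lia.
have row_a c : (a.2 <= c <= b.2)%N -> (a.1, c) \in A.
  by apply: hook_row => //; lia.
have col_b r : (a.1 <= r <= b.1)%N -> (r, b.2) \in A.
  by apply: hook_col => //; lia.
have cA : (a.1, b.2) \in A by apply: row_a; lia.
have vac : v a < v (a.1, b.2) by apply: vA.1.
have vcb : v (a.1, b.2) < v b by apply: vA.2.
have [ab2S|ab2S] := eqVneq b.2 a.2.+1.
  apply: (@swap_with_witness _ _ (b.1.-1, b.2) _ _ las lbt) => //.
  - by apply: col_b; lia.
  - move=> p pA pw; rewrite !inE.
    have [/amin -> //|pa] := boolP (sw p a); first by rewrite eqxx.
    have [/bmin -> //|pb] := boolP (sw p b); first by rewrite eqxx orbT.
    suff -> : p = (b.1.-1, b.2) by rewrite eqxx !orbT.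
    by apply: box_eq; move: pa pb pw; rewrite /sw /=; lia.
  - apply/andP; split; last by apply: vA.2 => //=; rewrite ?col_b //; lia.
    have [e|ne] := eqVneq a.1 b.1.-1; first by rewrite -e.
    by apply: lt_trans vac _; apply: vA.2 => //=; rewrite ?col_b //; lia.
(* The boxes of [B] are the only possible obstructions to taking the box to the right of [a] as
   witness. *)
pose B := restr A (fun p => (p.2 == a.2.+1) && (a.1 < p.1)%N).
have [B0|] := eqVneq B fset0.
  apply: (@swap_with_witness _ _ (a.1, a.2.+1) _ _ las lbt) => //.
  - by apply: row_a; lia.
  - move=> p pA pw; rewrite !inE.
    have [/amin -> //|pa] := boolP (sw p a); first by rewrite eqxx.
    suff -> : p = (a.1, a.2.+1) by rewrite eqxx !orbT.
    have : p \notin B by rewrite B0.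
    rewrite in_restr pA /= => pB.
    by apply: box_eq; move: pa pB pw; rewrite /sw /=; lia.
  - apply/andP; split; first by apply: vA.1 => //=; rewrite ?row_a //; lia.
    by apply: lt_trans vcb; apply: vA.1 => //=; rewrite ?row_a //; lia.
case/fset0Pn => e0 e0B.
have [e] : exists e : box, minimal_in B e.
  have [l mB] := row_listingP B; case: (row_listing B) l mB => [|e l] he me.
    by have := me e0; rewrite e0B.
  by exists e; have [] := (listing_cons B e l).1 (conj he me).
case=> eB emin; have := eB; rewrite in_restr => /and3P[eA /eqP e2 e1].
have le : listing A (e :: row_listing (A `\ e)).
  apply/listing_cons; split; last exact: row_listingP.
  split=> // p pA pe.
  have [pa|pa] := boolP (sw p a).
    by move: pe e1; rewrite (amin _ pA pa) /sw; lia.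
  by apply: emin => //; rewrite in_restr pA /=; move: pe pa; rewrite /sw; lia.
(* The column of [e] is strictly between those of [a] and [b], so exchanging [a] with [e] and [e]
   with [b] both fall under the induction on the column distance. *)
apply: (@KK_trans (map v (e :: row_listing (A `\ e)))).
  by apply: IHn => //; lia.
apply: IHn => //; [lia | | lia].
rewrite ltnNge; apply/negP => be; have eb : e = b by apply: bmin; rewrite // /sw; lia.
by move: e2; rewrite eb; lia.
Qed.

End StrictTableaux.

(** Induction on the number of boxes. Two distinct first boxes are both minimal, so one is strictly
    north-west of the other and [swap_minimal_NW] applies. *)
Lemma strict_reading_words v A s t : hook_closed A -> increasing_on v A ->
  listing A s -> listing A t -> map v s ~K map v t.
Proof.
elim: {s}(size s) {-2}s (leqnn (size s)) A t => [|n IHn] s sn A t hA vA ls lt.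
  have s0 : s = [::] by case: s sn {ls}.
  have t0 : t = [::].
    by case: t lt => // b t [_ m]; have := m b; rewrite -ls.2 s0 mem_head.
  by rewrite s0 t0; apply: KK_refl.
case: s sn ls => [|a s] sn ls.
  have -> : t = [::] by case: t lt => // b t [_ m]; have := m b; rewrite -ls.2 mem_head.
  exact: KK_refl.
case: t lt => [lt|b t lt].
  by have := ls.2 a; rewrite -lt.2 mem_head.
have IH x (l m : seq box) : x \in A -> hook_closed (A `\ x) ->
  listing (A `\ x) l -> listing (A `\ x) m -> map v l ~K map v m.
  move=> xA hAx ll lm; apply: (IHn _ _ (A `\ x)) => //.
    suff : size (x :: l) = size (a :: s) by case=> ->.
    apply/perm_size/uniq_perm; rewrite ?(listing_uniq ls) //=.
      by rewrite (listing_uniq ll) ll.2 !inE eqxx.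
    by move=> p; rewrite ls.2 inE ll.2 !inE; case: eqP => // ->.
  by apply: increasing_onS vA => p; rewrite !inE => /andP[].
have [[aA amin] sA] := (listing_cons _ _ _).1 ls.
have [[bA bmin] tA] := (listing_cons _ _ _).1 lt.
have [e|/eqP ne] := eqVneq a b.
  rewrite -e in tA *; apply: KK_cons; apply: (IH a) => //.
  by apply: hook_closed_minimal.
have nab : ~~ sw a b by apply/negP => /(bmin _ aA).
have nba : ~~ sw b a by apply/negP => /(amin _ bA) /esym.
have [ab|ba] := ltnP a.1 b.1.
  apply: (swap_minimal_NW hA vA IH (leqnn _)) => //.
  by move: nba; rewrite /sw; lia.
apply: KK_sym; apply: (swap_minimal_NW hA vA IH (leqnn _)) => //.
  by move: nba nab; rewrite /sw; lia.
by move: nba nab; rewrite /sw; lia.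
Qed.

(** * One dot *)

Lemma listing_eq A B s : (forall p : box, (p \in A) = (p \in B)) ->
  listing A s -> listing B s.
Proof. by move=> AB [h m]; split=> // p; rewrite m AB. Qed.

Lemma listing_restr_cat A (P Q R : box -> bool) s t :
  listing (restr A P) s -> listing (restr A Q) t ->
  (forall p q, P p -> Q q -> ~~ sw q p) -> (forall p, R p = P p || Q p) ->
  listing (restr A R) (s ++ t).
Proof.
move=> ls lt PQ RPQ; apply: (listing_cat ls lt) => [p|p q].
  by rewrite !in_restr -andb_orr RPQ.
by rewrite !in_restr => /andP[_ ?] /andP[_ ?]; apply: PQ.
Qed.

Lemma listing1 A (a : box) : a \in A ->
  listing (restr A (fun p => (p.1 == a.1) && (p.2 == a.2))) [:: a].
Proof.
move=> aA; split=> // p; rewrite in_restr inE -pair_eqE /=.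
by case: andP => [[/eqP h1 /eqP h2]|]; rewrite ?andbF // (box_eq h1 h2) aA.
Qed.

Lemma all_listing v A (P : pred int) s : listing A s ->
  (forall p : box, p \in A -> P (v p)) -> all P (map v s).
Proof. by move=> [_ ms] h; rewrite all_map; apply/allP => p; rewrite ms; apply: h. Qed.

Lemma row_word_incr v A r s : increasing_on v A -> listing A s ->
  (forall p : box, p \in A -> p.1 = r) -> pairwise <%R (map v s).
Proof.
move=> vA [ps ms] hr; rewrite pairwise_map.
apply: (@sub_in_pairwise _ (mem A)) ps; last by apply/allP => p; rewrite ms.
move=> p q pA qA /=; rewrite /sw => pq; have := hr _ pA; have := hr _ qA.
by move=> hq hp; apply: vA.1 => //; move: hp hq pq => /=; lia.
Qed.

Lemma col_word_decr v A c s : increasing_on v A -> listing A s ->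
  (forall p : box, p \in A -> p.2 = c) -> pairwise >%R (map v s).
Proof.
move=> vA [ps ms] hr; rewrite pairwise_map.
apply: (@sub_in_pairwise _ (mem A)) ps; last by apply/allP => p; rewrite ms.
move=> p q pA qA /=; rewrite /sw => pq; have := hr _ pA; have := hr _ qA.
by move=> hq hp; apply: vA.2 => //; move: hp hq pq => /=; lia.
Qed.

(* Truncated predecessors: only meaningful off column 0, resp. row 0. *)
Definition left_of (d : box) : box := (d.1, d.2.-1).
Definition above (d : box) : box := (d.1.-1, d.2).

Definition dot_neighbours (v : box -> int) (A : {fset box}) (d : box) : Prop :=
  [/\ d \in A, (0 < d.2)%N, left_of d \in A, below d \in A & v (left_of d) < v (below d)].

(* The strict inequalities count a tie between the upper and left (right and
   lower) neighbours as the first (second) case. *)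
Definition resolves (v : box -> int) (A : {fset box}) (d : box) (z : int) : Prop :=
  [\/ z = v (left_of d),
      z = v (below d),
      [/\ (0 < d.1)%N, above d \in A, v (left_of d) < v (above d) & z = v (above d)]
    | [/\ right_of d \in A, v (right_of d) < v (below d) & z = v (right_of d)]].

(* All conditions (ii) and (iii) on a reading word for the box [p] hold as soon
   as only boxes south-west of [p] are listed before [p]. *)
Definition leader (p : box) (s : seq box) : Prop :=
  exists s1 s2, s = s1 ++ p :: s2 /\ all (sw^~ p) s1.

Lemma leader_catr p s t : leader p s -> leader p (s ++ t).
Proof. by case=> s1 [s2 [-> h]]; exists s1, (s2 ++ t); rewrite -catA. Qed.

Lemma leader_catl p s t : all (sw^~ p) s -> leader p t -> leader p (s ++ t).
Proof.
by move=> hs [s1 [s2 [-> h]]]; exists (s ++ s1), s2; rewrite -catA all_cat hs.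
Qed.

Section FirstDot.

Variables (v : box -> int) (A : {fset box}) (d : box).
Hypotheses (hookA : hook_closed A) (dA : dot_neighbours v A d).
(** The boxes strictly north-east of [d] are left out because the later dots lie there. *)
Hypothesis vA : increasing_on v (restr A (fun p => (p != d) && ((p.2 <= d.2) || (d.1 <= p.1))%N)).

Let x := left_of d.
Let y := below d.
Let corner := row_listing (restr A (fun p => (d.1 < p.1) && (p.2 < d.2))%N).
Let row_part := row_listing (restr A (fun p => (p.1 == d.1) && (p.2 < d.2.-1))%N).
Let col_part := row_listing (restr A (fun p => (p.2 == d.2) && (d.1.+1 < p.1))%N).


Lemma listing_left : listing (restr A (sw^~ x)) (corner ++ row_part ++ [:: x]).
Proof.
have [dinA d2 xA yA _] := dA.
apply: (listing_restr_cat (row_listingP _)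
         (listing_restr_cat (row_listingP _) (listing1 xA) _ (fun=> erefl))).
all: by rewrite /sw /=; lia.
Qed.

Lemma listing_below : listing (restr A (sw^~ y)) (corner ++ col_part ++ [:: y]).
Proof.
have [dinA d2 xA yA _] := dA.
apply: (listing_restr_cat (row_listingP _)
         (listing_restr_cat (row_listingP _) (listing1 yA) _ (fun=> erefl))).
all: by rewrite /sw /=; lia.
Qed.

(** Only boxes south-west of [x] come before [x], as condition (iii) demands if the dot gets the
    value of [x]. The next listing does the same for [y] and condition (ii). *)
Lemma listing_left_first :
  listing (restr A (sw^~ d)) ((corner ++ row_part ++ [:: x]) ++ col_part ++ [:: y] ++ [:: d]).
Proof.
have [dinA d2 xA yA _] := dA.
apply: (listing_restr_cat listing_left (listing_restr_cat (row_listingP _)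
  (listing_restr_cat (listing1 yA) (listing1 dinA) _ (fun=> erefl)) _ (fun=> erefl))).
all: by rewrite /sw /=; lia.
Qed.

Lemma listing_below_first :
  listing (restr A (sw^~ d)) ((corner ++ col_part ++ [:: y]) ++ row_part ++ [:: x] ++ [:: d]).
Proof.
have [dinA d2 xA yA _] := dA.
apply: (listing_restr_cat listing_below (listing_restr_cat (row_listingP _)
  (listing_restr_cat (listing1 xA) (listing1 dinA) _ (fun=> erefl)) _ (fun=> erefl))).
all: by rewrite /sw /=; lia.
Qed.

Let row_incr (a b : box) : a \in A -> b \in A -> a != d -> b != d ->
  ((a.2 <= d.2) || (d.1 <= a.1))%N -> ((b.2 <= d.2) || (d.1 <= b.1))%N ->
  a.1 = b.1 -> (a.2 < b.2)%N -> v a < v b.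
Proof. by move=> aA bA ad bd ca cb; apply: vA.1; rewrite in_restr ?aA ?bA ?ad ?bd. Qed.

Let col_incr (a b : box) : a \in A -> b \in A -> a != d -> b != d ->
  ((a.2 <= d.2) || (d.1 <= a.1))%N -> ((b.2 <= d.2) || (d.1 <= b.1))%N ->
  a.2 = b.2 -> (a.1 < b.1)%N -> v a < v b.
Proof. by move=> aA bA ad bd ca cb; apply: vA.2; rewrite in_restr ?aA ?bA ?ad ?bd. Qed.

Let neq_d (p : box) : p.1 <> d.1 \/ p.2 <> d.2 -> p != d.
Proof. by move=> h; apply/eqP => e; move: h; rewrite e; case. Qed.

Let pre := map v corner ++ map v row_part ++ map v col_part.

Let row_sorted : pairwise <%R (map v row_part).
Proof.
apply: (@row_word_incr _ _ d.1 _ _ (row_listingP _)) => [|p].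
  apply: increasing_onS vA => p; rewrite !in_restr => /andP[-> hp] /=.
  by rewrite neq_d; lia.
by rewrite in_restr; lia.
Qed.

Let row_small : all (< v x) (map v row_part).
Proof.
have [dinA d2 xA yA _] := dA.
apply: all_listing (row_listingP _) _ => p; rewrite in_restr => /andP[pA hp].
by apply: row_incr => //; rewrite ?neq_d /x /left_of //=; lia.
Qed.

Let col_sorted : pairwise >%R (map v col_part).
Proof.
apply: (@col_word_decr _ _ d.2 _ _ (row_listingP _)) => [|p].
  apply: increasing_onS vA => p; rewrite !in_restr => /andP[-> hp] /=.
  by rewrite neq_d; lia.
by rewrite in_restr; lia.
Qed.

Let col_big : all (> v y) (map v col_part).
Proof.
have [dinA d2 xA yA _] := dA.
apply: all_listing (row_listingP _) _ => p; rewrite in_restr => /andP[pA hp].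
by apply: col_incr => //; rewrite ?neq_d /y /below //=; lia.
Qed.

Let vxy : v x < v y. Proof. by case: dA. Qed.

(** [x] passes the decreasing column, whose letters exceed [v y], with [v y] as witness. *)
Lemma word_left_first t :
  map v (corner ++ row_part ++ [:: x]) ++ map v col_part ++ v y :: t
    ~K pre ++ [:: v x, v y & t].
Proof.
rewrite /pre !map_cat -!catA; do 2 apply: KK_catl.
apply: KK_sym; apply: (@KK_commute _ [:: v x]); rewrite //= ?vxy //.
Qed.

(** The increasing row passes the column together with [y]; the witness is [v x]. *)
Lemma word_below_first t :
  map v (corner ++ col_part ++ [:: y]) ++ map v row_part ++ v x :: t
    ~K pre ++ [:: v y, v x & t].
Proof.
rewrite /pre !map_cat -!catA; apply: KK_catl.
have := @KK_commute (rcons (map v col_part) (v y)) (map v row_part) (v x) t.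
rewrite -cats1 -!catA; apply=> //.
  by rewrite pairwise_cat allrel1r col_big col_sorted.
rewrite all_cat /= vxy !andbT; apply: sub_all col_big => z /=.
exact: lt_trans.
Qed.

(** Of the boxes south-west of [above d], those not south-west of [d] all lie in the row of
    [above d]. *)
Definition above_row :=
  row_listing (restr (restr A (fun p => ~~ sw p d)) (fun p => (p.1 == d.1.-1) && (p.2 < d.2))%N).

Definition right_col :=
  row_listing (restr (restr A (fun p => ~~ sw p d)) (fun p => (p.2 == d.2.+1) && (d.1 < p.1))%N).

Lemma listing_above : (0 < d.1)%N -> above d \in A ->
  listing (restr (restr A (fun p => ~~ sw p d)) (sw^~ (above d))) (above_row ++ [:: above d]).
Proof.
move=> d1 aA; have aA' : above d \in restr A (fun p => ~~ sw p d).
  by rewrite in_restr aA /sw /=; clear -d1; lia.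
apply: listing_eq (listing_restr_cat (row_listingP _) (listing1 aA') _ (fun=> erefl)).
  by move=> p; rewrite !in_restr /sw /=; clear -d1; lia.
by rewrite /sw /=; clear -d1; lia.
Qed.

Lemma listing_right : right_of d \in A ->
  listing (restr (restr A (fun p => ~~ sw p d)) (sw^~ (right_of d))) (right_col ++ [:: right_of d]).
Proof.
move=> aA; have aA' : right_of d \in restr A (fun p => ~~ sw p d).
  by rewrite in_restr aA /sw /=; clear; lia.
apply: listing_eq (listing_restr_cat (row_listingP _) (listing1 aA') _ (fun=> erefl)).
  by move=> p; rewrite !in_restr /sw /=; clear; lia.
by rewrite /sw /=; clear; lia.
Qed.

(** Both words are made to begin with [v y, v x], one by a Knuth move with witness [v (above d)],
    the other by the braid relation. Then [KK_dot_above] uses the beginning of [N]. *)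
Lemma word_dot_above N V : (0 < d.1)%N -> above d \in A -> v x < v (above d) ->
  N ~K map v (above_row ++ [:: above d]) ++ V ->
  [:: v x, v y, v (above d) & N] ~K [:: v x, v y, v x & N].
Proof.
move=> d1 aA vxa hN; have [dinA d2 xA yA _] := dA.
have vay : v (above d) < v y.
  by apply: col_incr => //; rewrite ?neq_d /y /below /above //=; clear -d1 d2; lia.
apply: (@KK_trans [:: v y, v x, v (above d) & N]).
  by apply: KK_right_witness; rewrite vxa.
apply: KK_sym; apply: KK_trans (KK_aba _ _ _) _.
have e t : t ++ map v (above_row ++ [:: above d]) ++ V =
           t ++ map v above_row ++ v (above d) :: V by rewrite map_cat -!catA.
apply: (KK_trans (KK_catl [:: v y; v x; v y] hN)).
apply: KK_trans (KK_sym (KK_catl [:: v y; v x; v (above d)] hN)).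
rewrite !e; apply: KK_dot_above; last by rewrite vxa.
  apply: (@row_word_incr _ _ d.1.-1 _ _ (row_listingP _)) => [|p].
    apply: increasing_onS vA => p; rewrite !in_restr => /andP[/andP[-> _] hp] /=.
    by rewrite neq_d; lia.
  by rewrite in_restr; lia.
apply: all_listing (row_listingP _) _ => p; rewrite !in_restr => /andP[/andP[pA _] hp].
(* This box stands between [p] and [above d], hence is in [A]. It bounds the row to its left and
   lies above [x]. *)
have qA : (d.1.-1, d.2.-1) \in A.
  have -> : d.1.-1 = p.1 by case/andP: hp => /eqP.
  by apply: (hook_row hookA pA aA) => /=; clear -hp; lia.
apply: (@le_lt_trans _ _ (v (d.1.-1, d.2.-1))).
  have [->//|/box_neq /= ne] := eqVneq p (d.1.-1, d.2.-1).
  by apply/ltW/row_incr; rewrite ?neq_d //=; clear -hp d1 d2 ne; lia.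
by apply: col_incr => //; rewrite ?neq_d /x /left_of //=; clear -d1 d2; lia.
Qed.

Lemma word_dot_right N V : right_of d \in A -> v (right_of d) < v y ->
  N ~K map v (right_col ++ [:: right_of d]) ++ V ->
  [:: v x, v y, v (right_of d) & N] ~K [:: v x, v y, v x & N].
Proof.
move=> bA vby hN; have [dinA d2 xA yA _] := dA.
have vxb : v x < v (right_of d).
  by apply: row_incr => //; rewrite ?neq_d /x /left_of /right_of //=; clear -d2; lia.
have e t : t ++ map v (right_col ++ [:: right_of d]) ++ V =
           t ++ map v right_col ++ v (right_of d) :: V by rewrite map_cat -!catA.
apply: (KK_trans (KK_catl [:: v x; v y; v (right_of d)] hN)).
apply: KK_trans (KK_sym (KK_catl [:: v x; v y; v x] hN)).
rewrite !e; apply: KK_sym; apply: KK_dot_right; last by rewrite vxb.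
  apply: (@col_word_decr _ _ d.2.+1 _ _ (row_listingP _)) => [|p].
    apply: increasing_onS vA => p; rewrite !in_restr => /andP[/andP[-> _] hp] /=.
    by rewrite neq_d; lia.
  by rewrite in_restr; lia.
apply: all_listing (row_listingP _) _ => p; rewrite !in_restr => /andP[/andP[pA _] hp].
have qA : (d.1.+1, d.2.+1) \in A.
  have -> : d.2.+1 = p.2 by case/andP: hp => /eqP.
  by apply: (hook_col hookA bA pA) => /=; clear -hp; lia.
apply: (@lt_le_trans _ _ (v (d.1.+1, d.2.+1))).
  by apply: row_incr => //; rewrite ?neq_d /y /below //=; clear -d2; lia.
have [->//|/box_neq /= ne] := eqVneq p (d.1.+1, d.2.+1).
by apply/ltW/col_incr; rewrite ?neq_d //=; clear -hp d2 ne; lia.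
Qed.

End FirstDot.

(** * All dots *)

Lemma sw_trans (a b c : box) : sw a b -> sw b c -> sw a c.
Proof. by rewrite /sw; lia. Qed.

(** The boxes south-west of [f] can be listed first, since anything south-west of one of them is
    among them. *)
Lemma strict_prefix v A f s t : hook_closed A -> increasing_on v A ->
  listing (restr A (sw^~ f)) s -> listing A t -> exists V, map v t ~K map v s ++ V.
Proof.
move=> hA vA ls lt; pose u := row_listing (restr A (fun p => ~~ sw p f)).
exists (map v u); rewrite -map_cat; apply: (strict_reading_words hA vA lt).
apply: listing_cat ls (row_listingP _) _ _ => [p|p q].
  by rewrite !in_restr; case: (p \in A) (sw p f) => [] [].
rewrite !in_restr => /andP[_ pf] /andP[_].
by apply: contra => qp; apply: sw_trans qp pf.
Qed.

Lemma leader_last A f s : listing (restr A (sw^~ f)) (s ++ [:: f]) -> leader f (s ++ [:: f]).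
Proof.
move=> ls; exists s, [::]; split=> //; apply/allP => p ps.
by have := ls.2 p; rewrite in_restr mem_cat ps => /esym /andP[].
Qed.

(* [N] does not depend on the resolution [T]. The second clause is needed for the
   dot preceding [ds], with [f] its upper or right neighbour. *)
Lemma dotted_words ds A v :
  hook_closed A ->
  pairwise (fun d e : box => (e.1 < d.1)%N && (d.2 < e.2)%N) ds ->
  (forall d : box, d \in ds -> dot_neighbours v A d) ->
  increasing_on v (restr A (fun p => p \notin ds)) ->
  exists N,
    (forall T : box -> int, (forall p : box, p \in A -> p \notin ds -> T p = v p) ->
       (forall d : box, d \in ds -> resolves v A d (T d)) ->
       exists s, [/\ listing A s,
         forall d : box, d \in ds -> [/\ leader d s,
           T d = v (left_of d) -> leader (left_of d) s
           & T d = v (below d) -> leader (below d) s]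
         & map T s ~K N]) /\
    (forall (f : box) s, f \in A -> (forall d : box, d \in ds -> sw f d && (f != d)) ->
       listing (restr A (sw^~ f)) s -> exists V, N ~K map v s ++ V).
Proof.
elim: ds A => [|d ds IH] A hA.
  move=> _ _ vA; have {}vA : increasing_on v A.
    by apply: increasing_onS vA => p; rewrite in_restr => ->.
  exists (map v (row_listing A)); split=> [T Tv _|f s fA _ ls].
    exists (row_listing A); split=> //; first exact: row_listingP.
    suff -> : map T (row_listing A) = map v (row_listing A) by apply: KK_refl.
    by apply/eq_in_map => p; rewrite (row_listingP A).2 => /Tv ->.
  exact: strict_prefix ls (row_listingP A).
rewrite pairwise_cons => /andP[/allP dds chain] dots vA.
have dd : d \in d :: ds by rewrite mem_head.
have dA := dots _ dd; have [dinA d2 xA yA vxy] := dA.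
have nds (p : box) : (p.2 <= d.2)%N || (d.1 <= p.1)%N -> p \notin ds.
  by move=> h; apply/negP => /dds; clear -h; lia.
set A' := restr A (fun p => ~~ sw p d).
have [||e eds||N [hT hf]] := IH A' => //.
- exact: hook_closed_nsw.
- have [] := dots e; first by rewrite inE eds orbT.
  have := dds _ eds; clear => h eA e2 lA bA ve.
  by split; rewrite ?in_restr ?eA ?lA ?bA //= /sw /=; lia.
- apply: increasing_onS vA => p; rewrite !in_restr inE => /andP[/andP[-> pd] pds] /=.
  rewrite negb_or pds andbT; apply: contra pd => /eqP ->.
  by rewrite /sw !leqnn.
have vd : increasing_on v
    (restr A (fun p => (p != d) && ((p.2 <= d.2) || (d.1 <= p.1))%N)).
  apply: increasing_onS vA => p; rewrite !in_restr inE negb_or.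
  by case/and3P=> -> -> /nds ->.
pose x := left_of d; pose y := below d.
have wl := word_left_first dA vd; have wb := word_below_first dA vd.
have ll := listing_left_first dA; have lb := listing_below_first dA.
have llx := listing_left dA; have lby := listing_below dA.
move: wl wb ll lb llx lby.
set corner := row_listing _; set row_part := row_listing _; set col_part := row_listing _.
set pre := map v corner ++ _ ++ _ => wl wb ll lb llx lby.
(* This is the form of the word when the dot takes the value [v x]. *)
exists (pre ++ [:: v x, v y, v x & N]); split.
  move=> T Tv Tr.
  have [||s [ls lds Ts]] := hT T.
  - move=> p; rewrite in_restr => /andP[pA pd] pds; apply: Tv => //.
    rewrite inE negb_or pds andbT; apply: contra pd => /eqP ->.
    by rewrite /sw !leqnn.
  - move=> e eds; have := Tr e; rewrite inE eds orbT => /(_ isT).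
    have := dds _ eds => h; case=> [->|->|[e1 aA va ->]|[bA vb ->]].
    + by constructor 1.
    + by constructor 2.
    + by constructor 3; split=> //; rewrite in_restr aA /= /sw /=; clear -h; lia.
    + by constructor 4; split=> //; rewrite in_restr bA /= /sw /=; clear -h; lia.
  (* If the dot gets the value of [y], condition (ii) forces [y] before [x]; otherwise [x] comes
     first. *)
  pose l := if T d == v y then (corner ++ col_part ++ [:: y]) ++ row_part ++ [:: x]
            else (corner ++ row_part ++ [:: x]) ++ col_part ++ [:: y].
  have lsB : listing (restr A (sw^~ d)) (l ++ [:: d]).
    by rewrite /l; case: ifP => _; rewrite -!catA in ll lb *.
  exists ((l ++ [:: d]) ++ s); split.
  - apply: listing_cat lsB ls _ _ => [p|p q].
      by rewrite !in_restr; case: (p \in A) (sw p d) => [] [].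
    rewrite !in_restr => /andP[_ pd] /andP[_]; apply: contra => qp.
    exact: sw_trans qp pd.
  - move=> e; rewrite inE => /predU1P[->|eds].
      split=> [|Tx|Ty]; apply: leader_catr; first exact: leader_last lsB.
        rewrite /l; case: eqP => [Ty|_]; first by move: vxy; rewrite -Tx -Ty ltxx.
        by rewrite -!catA 2!catA; apply/leader_catr/(@leader_last A); rewrite -catA.
      rewrite /l Ty eqxx -!catA 2!catA; by apply/leader_catr/(@leader_last A); rewrite -catA.
    (* The first block is south-west of every box north-east of [d], so the leaders of [s] remain
       leaders behind it. *)
    have sB_before f : sw d f -> all (sw^~ f) (l ++ [:: d]).
      by move=> df; apply/allP => p; rewrite lsB.2 in_restr => /andP[_ /sw_trans]; apply.
    have := dds _ eds => h; have [le lx ly] := lds _ eds.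
    split=> [|/lx|/ly]; [move: le| |]; apply: leader_catl; apply: sB_before;
      by rewrite /sw /=; clear -h; lia.
  - have -> : map T ((l ++ [:: d]) ++ s) = map v l ++ T d :: map T s.
      rewrite !map_cat -catA; congr (_ ++ _); apply/eq_in_map => p pl.
      have [] : p \in A /\ sw p d.
        by apply/andP; rewrite -(in_restr A (sw^~ d)) -lsB.2 mem_cat pl.
      move=> pA pd; apply: Tv => //; rewrite inE negb_or nds; last first.
        by move: pd; rewrite /sw; clear; lia.
      rewrite andbT; apply/eqP => e; have := listing_uniq lsB.
      by rewrite cat_uniq /= -e pl andbF.
    apply: KK_trans (KK_catl (map v l) (KK_cons (T d) Ts)) _.
    rewrite /l; case: eqP => [->|Tny].
      rewrite map_cat -catA (map_cat v row_part) -catA; apply: KK_trans (wb _) _.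
      by apply/KK_catl/KK_sym/KK_aba.
    rewrite map_cat -catA (map_cat v col_part) -catA; apply: KK_trans (wl _) _.
    apply: KK_catl.
    have := Tr _ dd; case=> [->|//|[d1 aA va ->]|[bA vb ->]]; first exact: KK_refl.
    (* [above d] is south-west of all later dots, so the second clause of the induction hypothesis
       lets [N] begin with its row up to [above d]. *)
    + have [||V hV] := hf (above d) _ _ _ (listing_above d1 aA); last first.
      * exact: (word_dot_above hA dA vd d1 aA va hV).
      * by move=> e /dds; rewrite /sw -pair_eqE /=; clear -d1; lia.
      * by rewrite in_restr aA /sw /=; clear -d1; lia.
    + have [||V hV] := hf (right_of d) _ _ _ (listing_right bA); last first.
      * exact: (word_dot_right hA dA vd bA vb hV).
      * by move=> e /dds; rewrite /sw -pair_eqE /=; clear; lia.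
      * by rewrite in_restr bA /sw /=; clear; lia.
move=> f s fA fds ls.
have /andP[fd /box_neq fnd] := fds _ dd.
have restr_incr g : sw g d -> g <> d -> increasing_on v (restr A (sw^~ g)).
  move=> gd gnd; apply: increasing_onS vA => p; rewrite !in_restr => /andP[-> pg] /=.
  rewrite inE negb_or nds ?andbT; last by move: pg gd; rewrite /sw; clear; lia.
  apply/eqP => e; apply: gnd; move: pg gd; rewrite e /sw => h1 h2.
  by apply: box_eq; clear -h1 h2; lia.
have restr_sw g : sw f g -> listing (restr (restr A (sw^~ g)) (sw^~ f)) s.
  move=> fg; apply: listing_eq ls => p; rewrite !in_restr.
  case pf: (sw p f); rewrite ?andbF // !andbT.
  by rewrite (sw_trans pf fg) andbT.
(* Since [f] differs from [d], it is south-west of [x] or of [y]. The boxes south-west of that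
   neighbour include no dot and can be listed first, beginning with [s]. *)
have [f2|f2] := ltnP f.2 d.2.
  have vAx : increasing_on v (restr A (sw^~ x)).
    apply: restr_incr; first by rewrite /sw /=; clear; lia.
    by move/(congr1 snd) => /=; clear -d2; lia.
  have fx : sw f x by move: fd; rewrite /sw /=; clear -f2; lia.
  have [V hV] := strict_prefix (hook_closed_sw hA) vAx (restr_sw x fx) llx.
  exists (V ++ map v col_part ++ [:: v y, v x & N]).
  apply: KK_trans (KK_sym (wl _)) _.
  by rewrite (catA _ V); apply: KK_catr.
have vAy : increasing_on v (restr A (sw^~ y)).
  apply: restr_incr; first by rewrite /sw /=; clear; lia.
  by move/(congr1 fst) => /=; clear; lia.
have fy : sw f y by move: fd; rewrite /sw /=; clear -f2 fnd; lia.
have [V hV] := strict_prefix (hook_closed_sw hA) vAy (restr_sw y fy) lby.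
exists (V ++ map v row_part ++ [:: v x, v y & N]).
apply: KK_trans (KK_catl pre (KK_aba _ _ _)) _.
apply: KK_trans (KK_sym (wb _)) _.
by rewrite (catA _ V); apply: KK_catr.
Qed.

(** * Resolutions *)

Lemma listing_index A s (a b : box) : listing A s -> a \in A -> b \in A ->
  b != a -> sw a b -> (index a s < index b s)%N.
Proof.
move=> ls aA bA ba ab; rewrite ltnNge leq_eqVlt negb_or; apply/andP; split.
  apply: contra ba => /eqP e; apply/eqP.
  by rewrite -(nth_index a (_ : b \in s)) ?ls.2 // e nth_index ?ls.2.
apply/negP => lt; move: ab; apply/negP.
have /(pairwiseP a) h := ls.1.
have := h _ _ _ _ lt; rewrite !nth_index ?ls.2 //; apply; rewrite inE index_mem ls.2 //.
Qed.

Lemma leader_index A s (p b : box) : listing A s -> leader p s -> b \in A ->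
  ~~ sw b p -> (index p s < index b s)%N.
Proof.
move=> ls [s1 [s2 [es h]]] bA nbp; have bs : b \in s by rewrite ls.2.
have us := listing_uniq ls; move: us bs; rewrite es cat_uniq /= negb_or.
case/and3P=> _ /andP[ps1 _] _ _.
have bs1 : b \notin s1 by apply: contra nbp => /(allP h).
rewrite !index_cat (negbTE ps1) (negbTE bs1) /= eqxx ltn_add2l.
by case: eqP => // e; move: nbp; rewrite e /sw !leqnn.
Qed.

Lemma right_of_left_of d : (0 < d.2)%N -> right_of (left_of d) = d.
Proof. by case: d => r [|c]. Qed.

Section DottedTableau.

Variables (T0 : dotted_map) (k : int).
Hypothesis hook0 : hook_closed (domf T0).
Hypothesis strict0 : strictly_increasing (replace_dots T0 (k%:Q + 2%:R^-1)).
Hypothesis dots0 : forall b : box, has_dot T0 b ->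
     (exists (a : box) (x : int), right_of a = b /\ has_int T0 a x) /\
     (exists (a : box) (x : int), below b = a /\ has_int T0 a x).

Definition dots : seq box :=
  row_listing (restr (domf T0) (fun b => T0.[? b]%fmap == Some None)).

(** [0] is a placeholder at dots and outside the shape, which makes the entries a total function. *)
Definition int_entry (b : box) : int := if T0.[? b]%fmap is Some (Some x) then x else 0.

Let half_entry (b : box) : rat :=
  if T0.[? b]%fmap is Some (Some x) then x%:Q else k%:Q + 2%:R^-1.

Let v := int_entry.

Lemma dotsP b : b \in dots -> has_dot T0 b.
Proof. by rewrite (row_listingP _).2 in_restr => /andP[_ /eqP]. Qed.

Lemma has_int_entry b : b \in domf T0 -> b \notin dots -> has_int T0 b (v b).
Proof.
rewrite (row_listingP _).2 in_restr /has_int /v /int_entry => bA; rewrite bA /=.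
by case: fndP => [? |]; [case: (T0 _) | rewrite bA].
Qed.

Lemma has_intE b x : has_int T0 b x -> [/\ b \in domf T0, b \notin dots & v b = x].
Proof.
move=> bx; have := bx; rewrite /has_int; case: fndP => // bA _.
split=> //; last by rewrite /v /int_entry bx.
by apply/negP => /dotsP; rewrite /has_dot bx.
Qed.

Lemma half_entryE b : b \in domf T0 ->
  (replace_dots T0 (k%:Q + 2%:R^-1)).[? b]%fmap = Some (half_entry b).
Proof.
move=> bA; rewrite /half_entry /replace_dots; case: fndP => [b1|]; last by rewrite bA.
by rewrite ffunE (in_fnd bA) /=; congr Some; congr (if T0 _ is Some _ then _ else _); apply: val_inj.
Qed.

(** Go from [a] along its row to [(a.1, b.2)], a box by hook-closedness, and then down to [b]. *)
Lemma half_entry_lt (a b : box) : a \in domf T0 -> b \in domf T0 ->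
  box_le a b -> a != b -> half_entry a < half_entry b.
Proof.
move=> aA bA; rewrite /box_le => /andP[ab1 ab2] /box_neq ne.
have cA : (a.1, b.2) \in domf T0 by apply: (hook_row hook0 aA bA ab1); rewrite ab2 leqnn.
have row : (a.2 < b.2)%N -> half_entry a < half_entry (a.1, b.2).
  move=> lt; apply: strict0.1 lt _ (half_entryE cA).
  by rewrite -surjective_pairing half_entryE.
have col : (a.1 < b.1)%N -> half_entry (a.1, b.2) < half_entry b.
  move=> lt; apply: strict0.2 lt (half_entryE cA) _.
  by rewrite -surjective_pairing half_entryE.
case: (ltngtP a.1 b.1) ab1 => // [/col lt1|e1] _;
  case: (ltngtP a.2 b.2) ab2 => // [/row lt2|e2] _.
- exact: lt_trans lt2 lt1.
- by move: lt1; rewrite -e2 -surjective_pairing.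
- by move: lt2; rewrite e1 -surjective_pairing.
- by case: ne.
Qed.

Lemma half_entry_int b : b \in domf T0 -> b \notin dots -> half_entry b = (v b)%:Q.
Proof. by move=> bA bD; rewrite /half_entry (has_int_entry bA bD). Qed.

Lemma half_entry_dot b : b \in dots -> half_entry b = k%:Q + 2%:R^-1.
Proof. by move/dotsP=> h; rewrite /half_entry h. Qed.

Lemma int_entry_lt (a b : box) : a \in domf T0 -> b \in domf T0 ->
  a \notin dots -> b \notin dots -> box_le a b -> a != b -> v a < v b.
Proof.
move=> aA bA aD bD ab ne; have := half_entry_lt aA bA ab ne.
by rewrite !half_entry_int // ltr_int.
Qed.

Lemma int_entry_le (a b : box) : a \in domf T0 -> b \in domf T0 ->
  a \notin dots -> b \notin dots -> box_le a b -> v a <= v b.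
Proof.
move=> aA bA aD bD ab; have [->//|ne] := eqVneq a b.
exact/ltW/int_entry_lt.
Qed.

Lemma dots_dom d : d \in dots -> d \in domf T0.
Proof. by rewrite (row_listingP _).2 in_restr => /andP[]. Qed.

Lemma dots_antichain d e : d \in dots -> e \in dots -> box_le d e -> d = e.
Proof.
move=> dD eD de; apply/eqP; apply: contraT => ne.
have := half_entry_lt (dots_dom dD) (dots_dom eD) de ne.
by rewrite !half_entry_dot // ltxx.
Qed.

(** All dots carry the same half-integer, so no two are comparable under [box_le]; the listing order
    decides which of them is south-west of the other. *)
Lemma dots_chain : pairwise (fun d e : box => (e.1 < d.1)%N && (d.2 < e.2)%N) dots.
Proof.
have [+ _] := row_listingP (restr (domf T0) (fun b => T0.[? b]%fmap == Some None)).
rewrite -/dots => h; apply: (@sub_in_pairwise _ (mem dots)) h; last exact/allP.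
move=> d e dD eD /= nde; have := @dots_antichain d e dD eD.
have := @dots_antichain e d eD dD; move: nde; rewrite /sw /box_le.
case: (ltnP e.1 d.1) => h1; case: (ltnP d.2 e.2) => h2 //=.
- by rewrite (ltnW h1) => _ /(_ isT) ed; move: h1; rewrite ed ltnn.
- by rewrite (ltnW h2) => _ _ /(_ isT) ed; move: h2; rewrite ed ltnn.
Qed.

Lemma dots_neighbours d : d \in dots -> dot_neighbours v (domf T0) d.
Proof.
move=> dD; have [[a [x [ad /has_intE[aA aD _]]]] [b [y [db /has_intE[bA bD _]]]]] :=
  dots0 (dotsP dD).
have ea : a = left_of d by rewrite -ad; case: (a).
rewrite -db in bA bD; rewrite ea in aA aD.
split=> //; first exact: dots_dom; first by rewrite -ad.
apply: int_entry_lt => //; first by rewrite /box_le /=; lia.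
by rewrite -pair_eqE /=; lia.
Qed.

Lemma neighbour_int (a d : box) : d \in dots -> a \in domf T0 ->
  above_or_left a d \/ above_or_left d a -> a \notin dots.
Proof.
move=> dD aA h; apply/negP => aD.
have : a = d.
  by case: h => [] [] e; [| |symmetry|symmetry]; apply: dots_antichain => //;
    rewrite -e /box_le /=; lia.
by case: h => [] [] <- /(congr1 (fun p => p.1 + p.2)%N) /=; lia.
Qed.

Lemma int_entry_incr : increasing_on v (restr (domf T0) (fun p => p \notin dots)).
Proof.
split=> a b; rewrite !in_restr => /andP[aA aD] /andP[bA bD] e lt.
  apply: int_entry_lt => //; first by rewrite /box_le e; lia.
  by apply/eqP => ab; move: lt; rewrite ab ltnn.
apply: int_entry_lt => //; first by rewrite /box_le e; lia.
by apply/eqP => ab; move: lt; rewrite ab ltnn.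
Qed.

Section Resolution.

Variable T : {fmap box -> int}.
Hypothesis resT : resolution T0 T.

Definition entry (b : box) : int := odflt 0 T.[? b]%fmap.

Lemma resolution_int b : b \in domf T0 -> b \notin dots -> T.[? b]%fmap = Some (v b).
Proof. by move=> bA bD; have := resT b; rewrite (has_int_entry bA bD). Qed.

(** Removal is ruled out because a dot has a left and a lower neighbour. *)
Lemma resolution_dot d : d \in dots ->
  exists2 z, T.[? d]%fmap = Some z & max_above_left T0 d z \/ min_below_right T0 d z.
Proof.
move=> dD; have := resT d; rewrite (dotsP dD).
have [dA d2 lA bA _] := dots_neighbours dD.
case=> [z h|z h|[] h]; [by exists z; auto|by exists z; auto| |].
  by have /negP[] := h (left_of d) (or_intror (right_of_left_of d2)).
by have /negP[] := h (below d) (or_introl erefl).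
Qed.

Lemma entryE b : b \in domf T0 -> T.[? b]%fmap = Some (entry b).
Proof.
move=> bA; rewrite /entry; have [bD|bD] := boolP (b \in dots).
  by have [z -> _] := resolution_dot bD.
by rewrite resolution_int.
Qed.

Lemma domf_resolution : domf T = domf T0.
Proof.
apply/fsetP => b; have [bA|bA] := boolP (b \in domf T0).
  by have := entryE bA; case: fndP.
by have := resT b; rewrite (not_fnd bA); case: fndP.
Qed.

Lemma entry_int b : b \in domf T0 -> b \notin dots -> entry b = v b.
Proof. by move=> bA bD; rewrite /entry resolution_int. Qed.

Lemma entry_dot_between (d : box) : d \in dots ->
  (forall p, above_or_left p d -> p \in domf T0 -> v p <= entry d) /\
  (forall p, above_or_left d p -> p \in domf T0 -> entry d <= v p).
Proof.
move=> dD; have [z ez] := resolution_dot dD; rewrite /entry ez /=.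
have cross p q : above_or_left p d -> above_or_left d q ->
    p \in domf T0 -> q \in domf T0 -> v p <= v q.
  move=> pd dq pA qA; apply: int_entry_le => //.
  - by apply: neighbour_int dD pA _; left.
  - by apply: neighbour_int dD qA _; right.
  - by case: pd dq => [] <- [] <-; rewrite /box_le /=; lia.
case=> [[[a ad /has_intE[aA aD ea]] h]|[[a ad /has_intE[aA aD ea]] h]]; split=> p pd pA.
- by apply: (h p) => //; apply: has_int_entry => //; apply: neighbour_int dD pA _; left.
- by rewrite -ea; apply: cross.
- by rewrite -ea; apply: cross.
- by apply: (h p) => //; apply: has_int_entry => //; apply: neighbour_int dD pA _; right.
Qed.

Lemma entry_resolves d : d \in dots -> resolves v (domf T0) d (entry d).
Proof.
move=> dD; have [lo hi] := entry_dot_between dD.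
have [dA d2 lA bA _] := dots_neighbours dD.
have {}lo := lo (left_of d) (or_intror (right_of_left_of d2)) lA.
have {}hi := hi (below d) (or_introl erefl) bA.
have [z ez] := resolution_dot dD; rewrite /entry ez /= in lo hi *.
case=> [[[a ad /has_intE[aA aD ea]] _]|[[a ad /has_intE[aA aD ea]] _]].
  case: ad => ad; last by constructor 1; rewrite -ea -ad; case: (a).
  have [->|ne] := eqVneq z (v (left_of d)); first by constructor 1.
  have e : a = above d by rewrite -ad; case: (a).
  rewrite e in aA ea; constructor 3; split=> //; first by rewrite -ad.
  by rewrite ea; lia.
case: ad => ad; first by constructor 2; rewrite -ea -ad.
have [->|ne] := eqVneq z (v (below d)); first by constructor 2.
rewrite -ad in aA ea; constructor 4; split=> //; rewrite ea; lia.
Qed.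

(** [a'] follows [a] and [b'] precedes [b] in a common row or column; for adjacent boxes [a'] is [b]
    and [b'] is [a]. At most one of [a], [b] is a dot, and its value is compared through the integer
    at [a'] or [b']. *)
Lemma entry_le (a b a' b' : box) :
  [/\ a \in domf T0, b \in domf T0, a' \in domf T0 & b' \in domf T0] ->
  above_or_left a a' -> above_or_left b' b -> box_le a' b -> box_le a b' ->
  entry a <= entry b.
Proof.
move=> [aA bA a'A b'A] aa' bb' a'b ab'.
have ab : box_le a b /\ a != b.
  move: a'b ab'; rewrite /box_le -pair_eqE /=.
  by case: aa' bb' => [] <- [] <- /=; lia.
have [aD|aD] := boolP (a \in dots).
  have bD : b \notin dots.
    by apply/negP => bD; case: ab => /(dots_antichain aD bD) ->; rewrite eqxx.
  rewrite (entry_int bA bD); apply: le_trans ((entry_dot_between aD).2 _ aa' a'A) _.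
  apply: int_entry_le => //; by apply: neighbour_int aD a'A _; right.
rewrite (entry_int aA aD); have [bD|bD] := boolP (b \in dots).
  apply: le_trans ((entry_dot_between bD).1 _ bb' b'A).
  apply: int_entry_le => //; by apply: neighbour_int bD b'A _; left.
by rewrite (entry_int bA bD); apply: int_entry_le => //; case: ab.
Qed.

Lemma resolution_weakly_increasing : weakly_increasing_tableau T.
Proof.
split; first by rewrite domf_resolution.
have entry_some b z : T.[? b]%fmap = Some z -> b \in domf T0 /\ z = entry b.
  rewrite -domf_resolution /entry => bz; rewrite bz; split=> //.
  by move: bz; case: fndP.
split=> [r c1 c2|c r1 r2] x1 x2 lt /entry_some[aA ->] /entry_some[bA ->].
  have row c : (c1 <= c <= c2)%N -> (r, c) \in domf T0 by apply: (hook_row hook0 aA bA).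
  apply: (@entry_le _ _ (r, c1.+1) (r, c2.-1)).
  - by rewrite aA bA !row //; lia.
  - by right.
  - by right; rewrite /right_of /= prednK //; lia.
  - by rewrite /box_le /= leqnn.
  - by rewrite /box_le /= leqnn; lia.
have col r : (r1 <= r <= r2)%N -> (r, c) \in domf T0 by apply: (hook_col hook0 aA bA).
apply: (@entry_le _ _ (r1.+1, c) (r2.-1, c)).
- by rewrite aA bA !col //; lia.
- by left.
- by left; rewrite /below /= prednK //; lia.
- by rewrite /box_le /= leqnn andbT.
- by rewrite /box_le /= leqnn; lia.
Qed.

(** Adjacent integers differ, so conditions (ii) and (iii) concern only a dot, or its left or lower
    neighbour of equal value. Each such box is a leader, and the boxes that must follow it are not
    south-west of it. *)
Lemma reading_order_listing s : listing (domf T0) s ->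
  (forall d, d \in dots -> [/\ leader d s,
     entry d = v (left_of d) -> leader (left_of d) s
     & entry d = v (below d) -> leader (below d) s]) ->
  reading_order T s.
Proof.
move=> ls hs; have us := listing_uniq ls.
have dT (b : box) : (b \in domf T) = (b \in domf T0) by rewrite domf_resolution.
split=> // [b|a b|a a' b|a a' b]; rewrite !dT.
- exact: ls.2.
- by move=> aA bA; apply: listing_index ls aA bA.
- move=> aA a'A bA aa'; rewrite !entryE // => -[e] ba.
  apply: leader_index ls _ bA _; last by move: ba; rewrite /sw /strictly_north_of; lia.
  have [aD|aD] := boolP (a \in dots); first by have [] := hs a aD.
  have [a'D|a'D] := boolP (a' \in dots).
    by have [_ _] := hs a' a'D; rewrite aa' e entry_int //; apply.
  have : v a' < v a.
    apply: int_entry_lt => //; first by rewrite -aa' /box_le /=; lia.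
    by rewrite -aa' -pair_eqE /=; lia.
  by rewrite -!entry_int // e ltxx.
- move=> aA a'A bA aa'; rewrite !entryE // => -[e] ba.
  apply: leader_index ls _ bA _; last by move: ba; rewrite /sw /strictly_east_of; lia.
  have [aD|aD] := boolP (a \in dots); first by have [] := hs a aD.
  have [a'D|a'D] := boolP (a' \in dots).
    have la : left_of a' = a by rewrite -aa'; case: (a).
    by have [_] := hs a' a'D; rewrite la e entry_int // => + _; apply.
  have : v a < v a'.
    apply: int_entry_lt => //; first by rewrite -aa' /box_le /=; lia.
    by rewrite -aa' -pair_eqE /=; lia.
  by rewrite -!entry_int // e ltxx.
Qed.

Lemma reading_word_listing s : listing (domf T0) s ->
  pmap (fun b : box => T.[? b]%fmap) s = map entry s.
Proof.
move=> ls; have : all (mem (domf T0)) s by apply/allP => b; rewrite ls.2.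
by elim: s {ls} => //= b s IH /andP[/entryE -> /IH ->].
Qed.

End Resolution.

End DottedTableau.

Theorem theorem5p9 (T0 : dotted_map)
  (hT0 : dotted_increasing_tableau T0)
  (hdots : forall b : box, has_dot T0 b ->
     (exists (a : box) (x : int), right_of a = b /\ has_int T0 a x) /\
     (exists (a : box) (x : int), below b = a /\ has_int T0 a x))
  (T1 T2 : {fmap box -> int})
  (hT1 : resolution T0 T1) (hT2 : resolution T0 T2) :
  K_Knuth_equivalent T1 T2.
Proof.
have [hook0 [k strict0]] := hT0.
(* [N] is obtained before any resolution is chosen, so both reading words can be compared with
   it. *)
have [N [words _]] := dotted_words hook0 (dots_chain hook0 strict0)
  (dots_neighbours hook0 strict0 hdots) (int_entry_incr hook0 strict0).
have read T : resolution T0 T -> exists2 w, reading_word T w & w ~K N.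
  move=> hT; have [||s [ls hs wN]] := words (entry T).
  - by move=> p pA pD; apply: (entry_int hT).
  - by move=> d dD; apply: (entry_resolves hook0 strict0 hdots hT).
  exists (map (entry T) s) => //; exists s.
    exact: (reading_order_listing hook0 strict0 hdots hT).
  by rewrite (reading_word_listing hook0 strict0 hdots hT).
have [w1 r1 e1] := read T1 hT1; have [w2 r2 e2] := read T2 hT2.
split; [exact: (resolution_weakly_increasing hook0 strict0 hdots)..|].
by exists w1, w2; split=> //; apply: KK_trans e1 (KK_sym e2).
Qed.
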